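(* Let $X$ be a Banach space of type $p$, $1<p\le 2$, with type constant $T_p(X)$, let $w=\frac{1-p}{p}$, and set $C(X)=2\,\frac{2^{1/p}}{1-2^{w}}\,T_p(X)$. Let $P\subset X$ be a set with $|P|=n$ and $D=\operatorname{diam} P$, and let $r\in[n]$ be an integer. Then there is a point $q\in X$ such that the ball $B\left(q,C(X)r^{w}D\right)$ intersects the convex hulls of at least $r^{-r}\binom{n}{r}$ of the $r$-tuples (that is, $r$-element subsets) of $P$.
   Context: For a positive integer $m$, $[m]=\{1,\dots,m\}$. $B(x,\rho)=\{y\in X:\|y-x\|\le\rho\}$ is the closed ball. A Banach space $X$ is of type $p$, for some $1<p\le 2$, if there is a constant $T_p(X)<\infty$ such that for every finite sequence of vectors $x_1,\dots,x_n\in X$, $$\int_0^1\Big\|\sum_{j=1}^n R_j(t)x_j\Big\|\,dt\le T_p(X)\Big(\sum_{j=1}^n\|x_j\|^p\Big)^{1/p},$$ where $\{R_j\}_{j\ge1}$ are the Rademacher functions. Thus the left-hand side is the average of $\|\sum_j \varepsilon_j x_j\|$ over all $2^n$ choices of signs $\varepsilon_j=\pm1$. $T_p(X)$ denotes the constant in this definition. *)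

(* Defs.v *)
From mathcomp Require Import all_boot all_order all_algebra finmap.
From mathcomp Require Import all_classical all_reals all_analysis.
Import Order.TTheory GRing.Theory Num.Theory numFieldNormedType.Exports.

Set Implicit Arguments.
Unset Strict Implicit.
Unset Printing Implicit Defensive.

Local Open Scope classical_set_scope.
Local Open Scope ring_scope.

Definition rademacher {R : realType} (j : nat) (t : R) : R :=
  Num.sg (sin (2 ^+ j * pi * t)).

(* [T] is an admissible value of the constant T_p(X), so X has type p when some
   such T exists.  The Rademacher functions are indexed from 1, hence the shift. *)
Definition type_constant {R : realType} (X : completeNormedModType R)
    (p T : R) : Prop :=
  forall (n : nat) (x : 'I_n -> X),
    (\int[lebesgue_measure]_(t in `[0%R, 1%R])
        `| \sum_(j < n) rademacher j.+1 t *: x j |%:E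
     <= (T * (\sum_(j < n) `| x j | `^ p) `^ p^-1)%:E)%E.

Definition convex_hull {R : realType} {X : normedModType R} (A : set X) : set X :=
  smallest (fun B : set X => convex_set B) A.

Definition diam {R : realType} {X : normedModType R} (A : set X) : R :=
  sup [set `|x - y| | x in A & y in A].

(* Not the library's [closed_ball], which is the closure of an open ball and
   hence empty when the radius is 0. *)
Definition cball {R : realType} {X : normedModType R} (x : X) (rho : R) : set X :=
  closed_ball_ Num.norm x rho.

(* Main.v *)
(** Maurey's empirical method.  For independent uniform f, g : 'I_r -> P, the
    expectation of `|\sum_j e_j (f_j - g_j)| does not depend on the signs e_j,
    because f_j and g_j can be exchanged.  Averaging over the Rademacher signs,
    the type inequality bounds it by T r^(1/p) D, so some g makes the mean of a
    random f lie within T r^w D of q := mean g on average.  By Markov's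
    inequality at least half of the functions f have their mean in the ball
    around q (all of them if r = 1), which is a proportion of at least r^-r.
    Finally, a random r-subset of P is obtained from a random f by enlarging the
    image of f to an r-set and applying a random permutation of P, so the
    proportion of good r-subsets is at least that of good functions. *)
Require Import Defs.
From mathcomp Require Import all_boot all_order all_algebra all_fingroup finmap.
From mathcomp Require Import all_classical all_reals all_analysis.
From mathcomp Require Import measurable_realfun ring lra.
Import Order.TTheory GRing.Theory Num.Theory numFieldNormedType.Exports.
Local Open Scope classical_set_scope.
Local Open Scope ring_scope.

(** * Rademacher functions: signs almost everywhere, measurability, integration *)

Lemma sin_ge0_eq0 {R : realType} (x : R) :
  0 <= x -> sin x = 0 -> exists k : nat, x = k%:R * pi.
Proof.
move=> x0 sx; have pi0 := pi_gt0 R.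
have /truncn_itv := divr_ge0 x0 (ltW pi0).
set k := Num.Def.trunc _ => /andP[kx xk]; exists k.
move: kx xk; rewrite ler_pdivlMr // ltr_pdivrMr // => kx xk.
(* Shifting by [k * pi] changes [sin] only by a sign and leaves a point of [[0, pi)], where [sin]
   vanishes only at 0. *)
move: sx; rewrite -(subrK (k%:R * pi) x) mulr_natl (alternatingn (@sinDpi R)).
move=> /eqP; rewrite mulf_eq0 signr_eq0 /= => /eqP s0.
move: kx; rewrite le_eqVlt => /orP[/eqP <-|kx].
  by rewrite mulr_natl subrr add0r.
have : 0 < sin (x - pi *+ k).
  apply: sin_gt0_pi; rewrite subr_gt0 -mulr_natl kx /= ltrBlDl.
  by rewrite -{2}(mul1r pi) -mulrDl natr1.
by rewrite s0 ltxx.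
Qed.

(** For [t >= 0] the zeros are the dyadic points [k / 2 ^ j], a countable and hence null set. *)
Lemma rademacher_neq0_ae {R : realType} (j : nat) :
  \forall t \ae (@lebesgue_measure R), 0 <= t -> rademacher j t != 0.
Proof.
pose Z : set R := \bigcup_k [set (k%:R / 2 ^+ j)].
have Zc : countable Z by apply: bigcup_countable => // k _; exact: countable1.
exists Z; split; last 2 first.
- exact: countable_lebesgue_measure0.
- move=> t /= /not_implyP[t0 /negP/negPn].
  rewrite /rademacher sgr_eq0 => /eqP s0.
  have [|k kE] := sin_ge0_eq0 _ _ s0.
    by rewrite !mulr_ge0 ?exprn_ge0 ?pi_ge0.
  exists k => //=.
  move: kE; rewrite mulrAC => /(mulIf (lt0r_neq0 (pi_gt0 R))) <-.
  by rewrite mulrAC mulfV ?mul1r // expf_neq0.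
exact: countable_measurable.
Qed.

Lemma measurable_rademacher {R : realType} (j : nat) :
  measurable_fun [set: R] (@rademacher R j).
Proof.
apply: measurableT_comp.
  apply: (nondecreasing_measurable measurableT).
  move=> x y xy; case: (sgrP x) => x0; case: (sgrP y) => y0; lra.
apply: continuous_measurable_fun.
move=> t; apply: continuous_comp; first exact: mulrl_continuous.
exact: continuous_sin.
Qed.

(** Since the [c j] take only the values -1, 0 and 1, every preimage is a finite union of finite
    intersections of their level sets, whatever [F] is. *)
Lemma measurable_fun_of_signs {R : realType} (n : nat) (c : 'I_n -> R -> R)
    (F : ('I_n -> R) -> R) :
  (forall j, measurable_fun [set: R] (c j)) ->
  (forall j t, c j t = 0 \/ `|c j t| = 1) ->
  measurable_fun [set: R] (fun t => F (c ^~ t)).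
Proof.
move=> cm cv _ Y mY; rewrite setTI.
(* A pair of booleans codes a value in {-1, 0, 1}; 0 has two codes, which is harmless for a
   union. *)
pose val (b : bool * bool) : R := b.1%:R - b.2%:R.
rewrite (_ : _ @^-1` _ = \bigcup_(s in [set s : {ffun 'I_n -> bool * bool} |
    Y (F (val \o s))]) \bigcap_j (c j @^-1` [set val (s j)])).
  apply: fin_bigcup_measurable; first exact: finite_finset.
  move=> s _; apply: fin_bigcap_measurable => // j _.
  by rewrite -[X in measurable X]setTI; apply: cm.
apply/seteqP; split => [t /= Yt|t [s /= Ys] st].
  pose s := [ffun j => (0 < c j t, c j t < 0)].
  have E : c ^~ t = val \o s.
    apply/funext => j; rewrite /= ffunE /val /=.
    case: (cv j t) => [->|]; first by rewrite ltxx subrr.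
    case: (ltrgtP (c j t) 0) => /= h.
    - by rewrite ltr0_norm // => h1; lra.
    - by rewrite gtr0_norm // => h1; lra.
    - by rewrite h normr0 => h1; lra.
  by exists s; [rewrite /= -E | move=> j _; rewrite /= -[LHS]/((c^~ t) j) E].
by rewrite (_ : c ^~ t = val \o s) //; apply/funext => j; rewrite /= st.
Qed.

(** Passes from the Rademacher integral to finite sums: at almost every [t] the Rademacher values
    form a sign vector, so the sum over [i] of the integrands is the constant [S] on an interval of
    length 1. *)
Lemma type_constant_sum_le {R : realType} {X : completeNormedModType R}
    (p T : R) (r : nat) (I : finType) (v : I -> 'I_r -> X) (S : R) :
  type_constant X p T ->
  (forall e : 'I_r -> R, (forall j, `|e j| = 1) ->
    \sum_i `|\sum_j e j *: v i j| = S) ->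
  S <= \sum_i T * (\sum_j `|v i j| `^ p) `^ p^-1.
Proof.
move=> hT hS; pose D := [set` `[0, 1 : R]].
pose G i t : \bar R := `|\sum_(j < r) rademacher j.+1 t *: v i j|%:E.
have mG i : measurable_fun D (G i).
  apply: measurable_funS measurableT _ _ => //.
  apply: measurableT_comp => //.
  apply: (@measurable_fun_of_signs _ _ (fun j => rademacher j.+1)
    (fun e => `|\sum_j e j *: v i j|)) => [j|j t].
    exact: measurable_rademacher.
  rewrite /rademacher; case: sgrP => _; [left|right|right] => //.
    by rewrite normr1.
  by rewrite normrN normr1.
have mD : measurable D by exact: measurable_itv.
rewrite -lee_fin -sumEFin.
have -> : S%:E = (\int[lebesgue_measure]_(t in D) (\sum_i G i t)%R)%E.
  transitivity (\int[lebesgue_measure]_(t in D) (cst S%:E t))%E.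
    have mu1 : lebesgue_measure D = 1%E.
      by rewrite /D lebesgue_measure_itv /= lte_fin ltr01 oppr0 adde0.
    rewrite integral_cst // -[LHS]mule1; congr (_ * _)%E.
    exact/esym/mu1.
  have S0 : 0 <= S.
    rewrite -(hS (fun=> 1)) => [|j]; last exact: normr1.
    exact: sumr_ge0.
  apply: ge0_ae_eq_integral => //.
  - exact: emeasurable_sum.
  - by move=> t _; apply: sume_ge0 => i _; rewrite lee_fin.
  apply: filterS (ae_foralln (@rademacher_neq0_ae R)) => t tn0.
  rewrite /D /= in_itv /= => /andP[t0 _].
  rewrite sumEFin hS // => j; move: (tn0 j.+1 t0).
  by rewrite /rademacher normr_sg sgr_eq0 => ->.
rewrite ge0_integral_sum //; last by move=> i t _; rewrite lee_fin.
by apply: lee_sum => i _; exact: hT.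
Qed.

(** * Counting: from functions ['I_r -> U] to [r]-subsets of [U] *)

Lemma ex_perm_imset (U : finType) (A B : {set U}) :
  #|A| = #|B| -> exists s : {perm U}, [set s x | x in A]%SET = B.
Proof.
move=> AB.
(* Listing each set before its complement makes the matching of equal positions send [A] onto
   [B]. *)
pose l (C : {set U}) := enum C ++ enum (~: C).
have lu C : uniq (l C).
  rewrite cat_uniq !enum_uniq andbT /=; apply/hasPn => x.
  by rewrite !mem_enum inE.
have lm C x : x \in l C by rewrite mem_cat !mem_enum inE orbN.
have ls C : size (l C) = #|U|.
  by rewrite size_cat -!cardE cardsC.
pose f x := nth x (l B) (index x (l A)).
have il x : (index x (l A) < #|U|)%N by rewrite -(ls A) index_mem.
have fi : injective f.
  move=> x y; rewrite /f (set_nth_default y) ?ls // => /eqP.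
  rewrite nth_uniq ?ls // => /eqP /(congr1 (nth x (l A))).
  by rewrite !nth_index.
exists (perm fi); apply/eqP; rewrite eqEcard; apply/andP; split; last first.
  by rewrite card_imset ?AB //; exact: perm_inj.
apply/fintype.subsetP => _ /imsetP[x xA ->]; rewrite permE /f /l.
have ix : (index x (enum A) < #|A|)%N by rewrite cardE index_mem mem_enum.
rewrite index_cat mem_enum xA nth_cat -cardE -AB ix -mem_enum mem_nth //.
by rewrite -cardE -AB.
Qed.

Lemma ex_superset_card (U : finType) (A : {set U}) (r : nat) :
  (#|A| <= r <= #|U|)%N -> exists2 B : {set U}, A \subset B & #|B| = r.
Proof.
move=> /andP[Ar rU].
pose B := [set x in take (r - #|A|) (enum (~: A))]%SET.
exists (A :|: B); first exact: finset.subsetUl.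
have BA : (A :&: B = finset.set0)%SET.
  apply/finset.setP => x; rewrite !inE; apply/negP => /andP[xA /mem_take].
  by rewrite mem_enum inE xA.
rewrite cardsU BA cards0 subn0 cardsE.
rewrite (card_uniqP _) ?take_uniq ?enum_uniq // size_takel ?subnKC //.
by rewrite -cardE leq_subLR cardsC.
Qed.

(** Double counting over pairs of a function [f] and a permutation [s]. Fix an [r]-set [E]
    containing the image of [f]: if [s] composed with [f] satisfies [Q], then [W] holds for
    [s @: E]. The first event has the proportion of [Q] among functions, the second that of [W]
    among [r]-sets. *)
Lemma card_ffun_transfer (U : finType) (r : nat)
    (Q : pred {ffun 'I_r -> U}) (W : pred {set U}) :
  (r <= #|U|)%N ->
  (forall (f : {ffun 'I_r -> U}) (S : {set U}), Q f -> #|S| = r ->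
     (forall j, f j \in S) -> W S) ->
  (#|Q| * 'C(#|U|, r) <= #|U| ^ r * #|[set S : {set U} | (#|S| == r) && W S]%SET|)%N.
Proof.
move=> rU QW; set G := [set _ | _]%SET.
pose K (E : {set U}) := (\sum_(s : {perm U}) (W (s @: E)))%N.
have KE (E F : {set U}) : #|E| = #|F| -> K E = K F.
  move=> /ex_perm_imset[s <-]; rewrite /K (reindex_inj (mulgI s)) /=.
  apply: eq_bigr => t _; congr (nat_of_bool (W _)).
  by rewrite -imset_comp; apply: eq_imset => x /=; rewrite permM.
have supE (f : {ffun 'I_r -> U}) : exists2 E : {set U},
    f @: 'I_r \subset E & #|E| = r.
  apply: ex_superset_card; rewrite rU andbT.
  by rewrite -[X in (_ <= X)%N]card_ord leq_imset_card.
have [|E0 _ E0r] := @ex_superset_card U finset.set0 r; first by rewrite cards0.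
have P0 : (0 < #|{perm U}|)%N by apply/card_gt0P; exists 1%g.
rewrite -(leq_pmul2l P0).
(* For fixed [s], composition with [s] permutes the functions, so each [s] contributes exactly
   [#|Q|]. *)
have -> : (#|{perm U}| * (#|Q| * 'C(#|U|, r)) =
    (\sum_(f : {ffun 'I_r -> U}) \sum_(s : {perm U}) Q [ffun j => s (f j)])
      * 'C(#|U|, r))%N.
  rewrite mulnA exchange_big /=; congr muln; rewrite -sum_nat_const.
  apply: eq_bigr => s _.
  rewrite -sum1_card big_mkcond /=.
  rewrite (reindex_inj (h := fun f : {ffun 'I_r -> U} => [ffun j => s (f j)])) /=.
    by apply: eq_bigr => f _; rewrite unfold_in; case: (Q _).
  move=> f g /ffunP fg; apply/ffunP => j; move: (fg j).
  by rewrite !ffunE => /perm_inj.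
(* [K] is constant on [r]-sets, so it may be summed over all of them; for fixed [s] their images are
   again all the [r]-sets, which yields [#|G|]. *)
have -> : (#|{perm U}| * (#|U| ^ r * #|G|) = #|U| ^ r * K E0 * 'C(#|U|, r))%N.
  rewrite mulnCA -mulnA; congr muln.
  rewrite (mulnC (K E0)) -card_draws -sum_nat_const.
  transitivity (\sum_(E in [set A : {set U} | #|A| == r]%SET) K E)%N; last first.
    by apply: eq_bigr => E; rewrite inE => /eqP Er; apply: KE; rewrite Er.
  rewrite exchange_big /= -sum_nat_const; apply: eq_bigr => s _.
  rewrite -sum1_card [RHS](reindex_inj (imset_inj (@perm_inj _ s^-1%g))) /=.
  rewrite [RHS]big_mkcond [LHS]big_mkcond; apply: eq_bigr => E _.
  rewrite !inE card_imset; last exact: perm_inj.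
  rewrite -imset_comp (eq_imset (g := id)); last first.
    by move=> x /=; rewrite permKV.
  by rewrite imset_id; case: eqP; case: (W E).
rewrite leq_mul2r; apply/orP; right.
have -> : (#|U| ^ r = #|{ffun 'I_r -> U}|)%N by rewrite card_ffun card_ord.
rewrite -sum_nat_const.
apply: leq_sum => f _; have [E fE Er] := supE f.
rewrite (KE E0 E) ?Er // /K; apply: leq_sum => s _.
case Qf: (Q _) => //; rewrite (QW _ _ Qf) //.
  by rewrite card_imset //; exact: perm_inj.
move=> j; rewrite ffunE; apply: imset_f.
by apply: (fintype.subsetP fE); apply: imset_f.
Qed.

(** * Averaging: Markov's inequality, sign symmetry and the choice of the centre *)

Lemma card_le_double_markov {R : realType} (I : finType) (F : I -> R) (M rho : R) :
  (forall i, 0 <= F i) -> 0 <= M -> 2 * M <= rho ->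
  \sum_i F i <= #|I|%:R * M ->
  (#|I| <= 2 * #|[pred i | (F i <= rho)%R]|)%N.
Proof.
move=> F0 M0 Mrho sumF.
rewrite -(cardC [pred i | F i <= rho]) mul2n -addnn leq_add2l.
set B := [predC _].
suff : (2 * #|B| <= #|I|)%N.
  by rewrite -(cardC [pred i | F i <= rho]) mul2n -addnn leq_add2r.
have sumB : \sum_(i in B) F i <= #|I|%:R * M.
  apply: le_trans sumF; rewrite [leRHS](bigID (mem B)) /= lerDl.
  exact: sumr_ge0.
have [B0|/card_gt0P[i0 Bi0]] := posnP #|B|; first by rewrite B0.
(* If [M = 0], every [F i] vanishes and no index could lie in [B]. *)
have {}M0 : 0 < M.
  rewrite lt_neqAle M0 andbT; apply/eqP => M0'.
  move: Bi0; rewrite !inE => /negP; apply.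
  apply: le_trans Mrho; move: sumF; rewrite -M0' !mulr0 => sumF.
  apply: le_trans sumF; rewrite (bigD1 i0) //= lerDl; exact: sumr_ge0.
rewrite -(ler_nat R) -(ler_pM2r M0); apply: le_trans sumB.
rewrite natrM -mulrA mulrCA mulr_natl -sumr_const; apply: ler_sum => i.
by rewrite !inE -ltNge => /ltW; apply: le_trans.
Qed.

(** The type inequality for the single vector [y] reads [|y| <= T * |y|]. *)
Lemma type_constant_ge1 {R : realType} {X : completeNormedModType R} (p T : R)
    (y : X) : p != 0 -> type_constant X p T -> y != 0 -> 1 <= T.
Proof.
move=> p0 hT y0.
rewrite -(ler_pM2r (_ : 0 < `|y|)) ?normr_gt0 // mul1r.
have sumE (F : unit -> R) : \sum_i F i = F tt.
  by rewrite (bigD1 tt) //= big1 ?addr0 // => -[].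
have := @type_constant_sum_le _ _ _ _ 1%N unit (fun _ _ => y) `|y| hT.
rewrite sumE big_ord1 -powRrM mulfV // powRr1 //; apply=> e e1.
by rewrite sumE big_ord1 normrZ e1 mul1r.
Qed.

(** Exchanging [f j] and [g j] wherever [e j = -1] is an involution on pairs that absorbs the
    signs. *)
Lemma sum_norm_sign_swap {R : realType} {X : normedModType R} (U : finType)
    (x : U -> X) (r : nat) (e : 'I_r -> R) : (forall j, `|e j| = 1) ->
  \sum_(fg : {ffun 'I_r -> U} * {ffun 'I_r -> U})
     `|\sum_j e j *: (x (fg.1 j) - x (fg.2 j))| =
  \sum_(fg : {ffun 'I_r -> U} * {ffun 'I_r -> U})
     `|\sum_j (x (fg.1 j) - x (fg.2 j))|.
Proof.
move=> e1.
pose h (fg : {ffun 'I_r -> U} * {ffun 'I_r -> U}) :=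
  ([ffun j => if 0 <= e j then fg.1 j else fg.2 j],
   [ffun j => if 0 <= e j then fg.2 j else fg.1 j]).
have hK : involutive h.
  move=> [f g]; rewrite [LHS]/h; congr (_, _); apply/ffunP => j.
    by rewrite !ffunE /=; case: (0 <= e j).
  by rewrite !ffunE /=; case: (0 <= e j).
rewrite [RHS](reindex_inj (inv_inj hK)) /=; apply: eq_bigr => -[f g] _ /=.
congr `|_|; apply: eq_bigr => j _; rewrite !ffunE.
case: ifPn => [/ger0_norm|]; last rewrite -ltNge => /ltr0_norm; rewrite e1.
  by move=> <-; rewrite scale1r.
by move=> /(congr1 -%R); rewrite opprK => <-; rewrite scaleN1r opprB.
Qed.

(** If every [g] failed, the sum over all pairs would exceed [N * N * M], whereas the type
    inequality applied to each pair bounds it by that number. *)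
Lemma exists_center_mean_le {R : realType} {X : completeNormedModType R}
    (p T D : R) (U : finType) (x : U -> X) (r : nat) (u0 : U) :
  0 < p -> 0 <= T -> type_constant X p T ->
  (forall a b, `|x a - x b| <= D) ->
  exists g : {ffun 'I_r -> U},
    \sum_(f : {ffun 'I_r -> U}) `|\sum_j (x (f j) - x (g j))|
      <= #|{ffun 'I_r -> U}|%:R * (T * (r%:R `^ p^-1 * D)).
Proof.
move=> p0 T0 hT xD; apply: contrapT => nex.
pose N : R := #|{ffun 'I_r -> U}|%:R; pose M := T * (r%:R `^ p^-1 * D).
have D0 : 0 <= D by apply: le_trans (xD u0 u0).
have lo : N * (N * M) < \sum_(g : {ffun 'I_r -> U}) \sum_(f : {ffun 'I_r -> U})
    `|\sum_j (x (f j) - x (g j))|.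
  rewrite {1}/N mulr_natl -sumr_const; apply: ltr_sum => [|g _].
    by apply/hasP; exists [ffun=> u0] => //; rewrite mem_index_enum.
  by rewrite ltNge; apply/negP => ?; apply: nex; exists g.
have := @type_constant_sum_le _ _ _ _ r _
  (fun (fg : {ffun 'I_r -> U} * {ffun 'I_r -> U}) j => x (fg.1 j) - x (fg.2 j))
  _ hT (@sum_norm_sign_swap _ _ _ x r).
apply/negP; rewrite -ltNge.
rewrite -(pair_bigA _ (fun f g : {ffun 'I_r -> U} =>
  `|\sum_j (x (f j) - x (g j))|)) /= exchange_big /=.
apply: le_lt_trans lo.
apply: (@le_trans _ _ (\sum_(fg : {ffun 'I_r -> U} * {ffun 'I_r -> U}) M)).
  apply: ler_sum => -[f g] _ /=; apply: ler_wpM2l => //.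
  have -> : r%:R `^ p^-1 * D = (r%:R * D `^ p) `^ p^-1.
    by rewrite powRM ?powR_ge0 // -powRrM mulfV ?gt_eqF // powRr1.
  apply: ge0_ler_powR; rewrite ?nnegrE ?invr_ge0 ?(ltW p0) //.
  - by apply: sumr_ge0 => j _; exact: powR_ge0.
  - by rewrite mulr_ge0 ?powR_ge0.
  have -> : r%:R * D `^ p = \sum_(j < r) D `^ p.
    by rewrite sumr_const card_ord mulr_natl.
  apply: ler_sum => j _.
  by apply: ge0_ler_powR; rewrite ?nnegrE ?(ltW p0).
by rewrite sumr_const card_prod -mulr_natl natrM mulrA.
Qed.

(** * Convex hulls, diameters and finite subsets *)

Lemma convex_hull_mean {R : realType} {X : normedModType R} (A : set X)
    (r : nat) (y : 'I_r.+1 -> X) :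
  (forall j, A (y j)) -> convex_hull A (r.+1%:R^-1 *: \sum_j y j).
Proof.
move=> yA B [cB AB]; have {yA} : forall j, B (y j) by move=> j; exact/AB.
elim: r y => [|r IH] y yB; first by rewrite invr1 scale1r big_ord1.
have r2 : 0 < r.+2%:R :> R by rewrite ltr0n.
have l0 : 0 <= r.+2%:R^-1 :> R by rewrite invr_ge0 ltW.
have l1 : r.+2%:R^-1 <= 1 :> R by rewrite invf_le1 // ler1n.
(* The mean of [r + 2] points gives weight [1 / (r + 2)] to the first and the remaining weight to
   the mean of the others. *)
have := cB (y ord0) (r.+1%:R^-1 *: \sum_j y (lift ord0 j)) (Itv01 l0 l1).
rewrite !in_setE => /(_ (yB _) (IH _ (fun j => yB _))).
suff -> : r.+2%:R^-1 *: \sum_j y j = r.+2%:R^-1 *: y ord0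
    + (1 - r.+2%:R^-1) *: (r.+1%:R^-1 *: \sum_j y (lift ord0 j)) by [].
rewrite big_ord_recl scalerDr scalerA; congr (_ + _ *: _).
have r1 : 0 < r.+1%:R :> R by rewrite ltr0n.
rewrite -natr1; field.
by rewrite nat1r natr1 !pnatr_eq0.
Qed.

Lemma norm_sub_le_diam {R : realType} {X : normedModType R} (P : {fset X}) :
  {in P &, forall a b, `|a - b| <= diam [set` P]}.
Proof.
move=> a b aP bP; apply: ub_le_sup; last by exists a => //; exists b.
(* The supremum needs an upper bound for the distances; the sum of all of them is one. *)
exists (\sum_(z : P * P) `|fsval z.1 - fsval z.2|) => _ [u uP [v vP <-]].
rewrite (bigD1 ([` uP], [` vP])%fset) //= lerDl; exact: sumr_ge0.
Qed.

Lemma card_sets_le_fset {K : choiceType} (P : {fset K}) (r : nat)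
    (W : pred {fset K}) :
  (#|[set S : {set P} | (#|S| == r) && W [fset val u | u in S]%fset]%SET|
    <= #|` [fset S in fpowerset P | (#|` S| == r) && W S]%fset|)%N.
Proof.
pose h (S : {set P}) : {fset K} := [fset val u | u in S]%fset.
have hi : injective h.
  move=> S S' /fsetP hS; apply/finset.setP => u.
  by move: (hS (val u)); rewrite !(mem_imfset _ _ val_inj).
have hc S : #|` h S| = #|S|.
  by rewrite card_imfset //=; [rewrite -cardE | exact: val_inj].
rewrite cardE -(size_map h); apply: uniq_leq_size.
  by rewrite map_inj_uniq ?enum_uniq.
move=> _ /mapP[S + ->]; rewrite mem_enum inE => /andP[/eqP Sr WS].
rewrite !inE /= hc Sr eqxx /= WS andbT fpowersetE.
by apply/fsubsetP => _ /imfsetP[u _ ->]; exact: valP.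
Qed.

Theorem theorem2 (R : realType) (X : completeNormedModType R) (p T : R)
    (hp : 1 < p <= 2) (hT : type_constant X p T)
    (P : {fset X}) (n r : nat) (hn : #|` P| = n) (hr : (1 <= r <= n)%N) :
  let w : R := (1 - p) / p in
  let C : R := 2 * (2 `^ p^-1 / (1 - 2 `^ w)) * T in
  let D : R := diam [set` P] in
  exists q : X,
    (r%:R : R) ^- r * 'C(n, r)%:R <=
    #|` [fset S in fpowerset P | (#|` S| == r) &&
          `[< cball q (C * r%:R `^ w * D) `&` convex_hull [set` S] !=set0 >]]%fset |%:R.
Proof.
move=> w C D; case/andP: hp => p1 _; case/andP: hr => r1 rn.
have p0 : 0 < p by lra.
have UP : #|{: P}| = n by rewrite -hn cardfE.
have /card_gt0P[u0 _] : (0 < #|{: P}|)%N by rewrite UP (leq_trans r1).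
have xD (a b : P) : `|val a - val b| <= D by apply: norm_sub_le_diam; exact: valP.
have D0 : 0 <= D := le_trans (normr_ge0 _) (xD u0 u0).
pose rho := C * r%:R `^ w * D.
have r0 : 0 < r%:R :> R by rewrite ltr0n.
pose N := #|{ffun 'I_r -> P}|.
(* It suffices that a proportion [r ^- r] of the functions is good, stated for sums: dividing by [r]
   turns the bound [r * rho] into the radius [rho] for means. *)
suff [g gN] : exists g : {ffun 'I_r -> P},
    (N <= r ^ r * #|[pred f : {ffun 'I_r -> P} |
       (`|\sum_j (val (f j) - val (g j))| <= r%:R * rho)%R]|)%N.
  pose mean (f : {ffun 'I_r -> P}) : X := r%:R^-1 *: \sum_j val (f j).
  exists (mean g); rewrite ler_pdivrMl ?exprn_gt0 // -natrX -natrM ler_nat.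
  have Np : (0 < N)%N by apply/card_gt0P; exists [ffun=> u0].
  rewrite -(leq_pmul2l Np).
  pose W (S : {fset X}) := `[< cball (mean g) rho `&` convex_hull [set` S] !=set0 >].
  have := card_sets_le_fset P r W.
  rewrite -(leq_pmul2l (_ : 0 < N * r ^ r)%N) ?muln_gt0 ?Np ?expn_gt0 ?r1 //.
  rewrite -!mulnA; apply: leq_trans.
  apply: leq_trans (leq_mul gN (leqnn _)) _.
  rewrite -mulnA [leqRHS]mulnCA leq_mul2l; apply/orP; right.
  rewrite /N card_ffun card_ord -UP; apply: card_ffun_transfer; first by rewrite UP.
  move=> f S; rewrite inE => fg _ fS; apply/asboolP; exists (mean f); split.
    rewrite /cball /closed_ball_ /= -scalerBr -sumrB normrZ.
    rewrite ger0_norm ?invr_ge0 ?(ltW r0) //.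
    by rewrite ler_pdivrMl // -(normrN) -sumrN; under eq_bigr do rewrite opprB.
  rewrite /mean; case: (r) r1 f fS {fg} => // r' _ f fS.
  by apply: convex_hull_mean => j; apply/imfsetP; exists (f j).
have r_wE : r%:R `^ p^-1 = r%:R * r%:R `^ w.
  have -> : p^-1 = 1 + w by rewrite /w mulrBl mul1r mulfV ?gt_eqF // addrC subrK.
  by rewrite powRD ?powRr1 ?ler0n // (gt_eqF r0) implybT.
(* If [D = 0], all points coincide and every [f] is good. Otherwise [X] has a nonzero vector, which
   forces [1 <= T]; in the zero space [T] could be negative. *)
have [D_0|D_neq0] := eqVneq D 0.
  exists [ffun=> u0].
  rewrite (_ : #|_| = N); first by rewrite leq_pmull // expn_gt0 r1.
  apply: eq_card => f; rewrite !inE /rho D_0 !mulr0.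
  rewrite (le_trans (ler_norm_sum _ _ _)) // big1 // => j _.
  by apply/eqP; rewrite eq_le normr_ge0 andbT -D_0.
have D_gt0 : 0 < D by rewrite lt0r D_neq0.
have [y y0] : exists y : X, y != 0.
  apply: contrapT => X0; move: D_gt0; apply/negP; rewrite -leNgt.
  have x0 (y : X) : y = 0 by apply: contrapT => y0; apply: X0; exists y; apply/eqP.
  have u0P : val u0 \in P := valP u0.
  apply: ge_sup; first by exists `|val u0 - val u0|, (val u0) => //; exists (val u0).
  by move=> _ [a _ [b _ <-]]; rewrite (x0 (a - b)) normr0.
have T1 : 1 <= T by apply: type_constant_ge1 hT y0; rewrite gt_eqF.
have T0 : 0 <= T by lra.
(* The factor [2 / (1 - 2 ^ w)]-type constant in [C] is at least twice 1: the numerator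
   [2 ^ (1 / p)] is at least 1 and the denominator lies in [(0, 1)]. The leading 2 is the one
   Markov's inequality consumes. *)
have rho_ge : 2 * (T * r%:R `^ w * D) <= rho.
  have -> : rho = 2 * (2 `^ p^-1 / (1 - 2 `^ w) * (T * r%:R `^ w * D)).
    by rewrite /rho /C !mulrA.
  rewrite ler_pM2l // ler_peMl ?mulr_ge0 ?powR_ge0 //.
  have w0 : w < 0 by rewrite /w ltr_pdivrMr // mul0r; lra.
  have e1 : 2 `^ w < 1 :> R.
    by rewrite /powR pnatr_eq0 /= expR_lt1 nmulr_rlt0 // ln_gt0 // ltr1n.
  have e2 : 0 < 2 `^ w :> R by rewrite powR_gt0.
  have e3 : 1 <= 2 `^ p^-1 :> R.
    rewrite -[leLHS](powRr0 2); apply: ler_powR; first by rewrite ler1n.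
    by rewrite invr_ge0 ltW.
  by rewrite ler_pdivlMr ?subr_gt0 // mul1r; lra.
have M0 : 0 <= T * r%:R `^ w * D by rewrite !mulr_ge0 ?powR_ge0.
(* For [r = 1] half of the functions is too few, as [r ^ r = 1]; but then [rho >= 2 * T * D >= D],
   so every point lies in the ball. *)
have [r_1|r_neq1] := eqVneq r 1%N.
  exists [ffun=> u0].
  rewrite (_ : #|_| = N); first by rewrite leq_pmull // expn_gt0 r1.
  apply: eq_card => f; rewrite !inE.
  apply: le_trans (ler_norm_sum _ _ _) _.
  apply: (@le_trans _ _ (\sum_(j < r) rho)); last first.
    by rewrite sumr_const card_ord mulr_natl.
  apply: ler_sum => j _; apply: le_trans (xD _ _) _; apply: le_trans rho_ge.
  rewrite r_1 powR1 mulr1 mulrA -{1}(mul1r D) ler_wpM2r //; lra.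
have r2 : (1 < r)%N by rewrite ltn_neqAle eq_sym r_neq1.
have [g gM] := @exists_center_mean_le _ _ _ _ _ _ val r u0 p0 T0 hT xD.
exists g.
(* Half is enough from here on, because [2 <= r <= r ^ r]. *)
apply: (@leq_trans (2 * #|[pred f : {ffun 'I_r -> P} |
       (`|\sum_j (val (f j) - val (g j))| <= r%:R * rho)%R]|)%N); last first.
  by rewrite leq_mul2r (leq_trans r2) ?orbT // -{1}(expn1 r) leq_exp2l.
apply: card_le_double_markov.
- by move=> f.
- by apply: mulr_ge0 M0; exact: ltW r0.
- by rewrite mulrCA ler_pM2l.
- have -> : r%:R * (T * r%:R `^ w * D) = T * (r%:R `^ p^-1 * D) by rewrite r_wE; ring.
  exact: gM.
Qed.
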